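(* There is an algorithm in the computational model described in the context that, for every word length $n$ and every input word $x$ of length $n$, outputs $\nu(x)$ using $O(\min(\nu(x),\,n-\nu(x)+\log n))$ steps under the unit cost measure.
   Context: $\nu(x)$ denotes the number of ones in the binary word $x$. Computational model: a program operates on unsigned integer variables, each holding an $n$-bit word. The input word $x$ is stored in a variable $x$; all other variables are initially zero. The available operations are increment and decrement (modulo $2^n$, so incrementing the all-ones word gives zero and decrementing zero gives the all-ones word), bitwise logical operations, and assignment (the only constant available, in assignments and comparisons, is zero). Control flow may depend on comparisons between variables or with zero. Each operation costs one unit (unit cost measure).
   Formalization: The program may depend on the word length n (same number of variables and O-constant for all n), since with zero as the only constant no single program handles all-ones words of every length in O(log n) steps; the O-bound is read as at least one step where the minimum is 0. *)

(* Defs.v *)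
From mathcomp Require Import all_boot.

Set Implicit Arguments.
Unset Strict Implicit.
Unset Printing Implicit Defensive.

(** * Words *)

(** Little endian: component [i] has weight [2 ^ i]. *)
Definition word (n : nat) := n.-tuple bool.

Definition nu n (x : word n) : nat := count id x.

Definition word_val n (x : word n) : nat := \sum_(i < n) tnth x i * 2 ^ i.

(** The [n]-bit word whose value is [m] modulo [2 ^ n]. *)
Definition word_of_nat n (m : nat) : word n := [tuple odd (m %/ 2 ^ i) | i < n].

Definition word_inc n (x : word n) : word n :=
  word_of_nat n ((word_val x + 1) %% 2 ^ n).

Definition word_dec n (x : word n) : word n :=
  word_of_nat n ((word_val x + (2 ^ n - 1)) %% 2 ^ n).

Definition word_map2 (f : bool -> bool -> bool) n (x y : word n) : word n :=
  [tuple f (tnth x i) (tnth y i) | i < n].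

Definition word_not n (x : word n) : word n := [tuple ~~ tnth x i | i < n].
Definition word_and n : word n -> word n -> word n := @word_map2 andb n.
Definition word_or n : word n -> word n -> word n := @word_map2 orb n.
Definition word_xor n : word n -> word n -> word n := @word_map2 addb n.

(** * Programs *)

(** A program over [k.+1] variables is pure syntax and does not mention the
    word length; variable [ord0] holds the input.  An algorithm is a family of
    programs indexed by the word length, over a fixed number of variables: no
    single program can count the ones of the all-ones word of every length [n]
    in [o(n)] steps, since a run of fewer than [n] steps on it does not depend
    on [n]. *)
Notation var k := ('I_k.+1).

Inductive operand (k : nat) := Var of var k | Zero.

Inductive cmp := Eq | Ne | Lt | Le | Gt | Ge.

Inductive test (k : nat) := Test of cmp & var k & operand k.

Inductive prog (k : nat) :=
| Skip
| Inc of var k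
| Dec of var k
| Assign of var k & operand k
| Not of var k & var k
| And of var k & var k & var k
| Or of var k & var k & var k
| Xor of var k & var k & var k
| Seq of prog k & prog k
| If of test k & prog k & prog k
| While of test k & prog k.

Arguments Zero {k}.
Arguments Skip {k}.

Definition state (n k : nat) := {ffun var k -> word n}.

Definition init n k (x : word n) : state n k :=
  [ffun v => if v == ord0 then x else word_of_nat n 0].

Definition upd n k (s : state n k) (v : var k) (w : word n) : state n k :=
  [ffun u => if u == v then w else s u].

Definition eval_operand n k (s : state n k) (a : operand k) : word n :=
  match a with
  | Var v => s v
  | Zero => word_of_nat n 0
  end.

Definition eval_cmp (c : cmp) (a b : nat) : bool :=
  match c with
  | Eq => a == b
  | Ne => a != b
  | Lt => a < b
  | Le => a <= b
  | Gt => a > b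
  | Ge => a >= b
  end.

Definition eval_test n k (s : state n k) (b : test k) : bool :=
  let: Test c v a := b in
  eval_cmp c (word_val (s v)) (word_val (eval_operand s a)).

(** [exec p s t s'] means that [p], started in [s], halts in [s'] after [t]
    steps.  Every executed operation costs one step, and so does every
    evaluation of a test; sequencing and [Skip] are not operations. *)
Inductive exec n k : prog k -> state n k -> nat -> state n k -> Prop :=
| ExecSkip s : exec Skip s 0 s
| ExecInc v s : exec (Inc v) s 1 (upd s v (word_inc (s v)))
| ExecDec v s : exec (Dec v) s 1 (upd s v (word_dec (s v)))
| ExecAssign v a s : exec (Assign v a) s 1 (upd s v (eval_operand s a))
| ExecNot v a s : exec (Not v a) s 1 (upd s v (word_not (s a)))
| ExecAnd v a b s : exec (And v a b) s 1 (upd s v (word_and (s a) (s b)))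
| ExecOr v a b s : exec (Or v a b) s 1 (upd s v (word_or (s a) (s b)))
| ExecXor v a b s : exec (Xor v a b) s 1 (upd s v (word_xor (s a) (s b)))
| ExecSeq p q s1 t1 s2 t2 s3 :
    exec p s1 t1 s2 -> exec q s2 t2 s3 -> exec (Seq p q) s1 (t1 + t2) s3
| ExecIfTrue b p q s t s' :
    eval_test s b -> exec p s t s' -> exec (If b p q) s t.+1 s'
| ExecIfFalse b p q s t s' :
    ~~ eval_test s b -> exec q s t s' -> exec (If b p q) s t.+1 s'
| ExecWhileTrue b p s1 t1 s2 t2 s3 :
    eval_test s1 b -> exec p s1 t1 s2 -> exec (While b p) s2 t2 s3 ->
    exec (While b p) s1 (t1 + t2).+1 s3
| ExecWhileFalse b p s :
    ~~ eval_test s b -> exec (While b p) s 1 s.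

(* Main.v *)
(* Replacing [x] by [x & (x - 1)] clears its lowest one.  The program clears the
   lowest one of the input and of its complement in lockstep, counting the
   rounds.  If the input vanishes first, the count is [nu x] and nothing more is
   paid.  Otherwise the count is [n - nu x]; only then is [n] assembled from its
   binary digits, in [O(log n)] steps, and the count subtracted from it.  In that
   case [n < 2 * nu x], so the cost [O(n - nu x + log n)] is also [O(nu x)]. *)
Require Import Defs.
From mathcomp Require Import all_boot.
From mathcomp Require Import zify.

Set Implicit Arguments.
Unset Strict Implicit.
Unset Printing Implicit Defensive.

(** * Words as numbers modulo a power of two, and their ones *)

Lemma word_val_cons n b (x : word n) :
  word_val [tuple of b :: x] = b + (word_val x).*2.
Proof.
rewrite /word_val big_ord_recl tnth0 muln1 -mul2n big_distrr /=.
congr (_ + _); apply: eq_bigr => i _.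
by rewrite tnthS expnS mulnCA.
Qed.

Lemma word_of_nat_cons n m :
  word_of_nat n.+1 m = [tuple of odd m :: word_of_nat n m./2].
Proof.
apply: eq_from_tnth => i; rewrite tnth_mktuple.
case: (unliftP ord0 i) => [j|] ->; last by rewrite tnth0 divn1.
by rewrite tnthS tnth_mktuple /= /bump /= add1n expnS divnMA divn2.
Qed.

Lemma word_of_natK n m : word_val (word_of_nat n m) = m %% 2 ^ n.
Proof.
elim: n m => [|n IHn] m; first by rewrite /word_val big_ord0 modn1.
rewrite word_of_nat_cons word_val_cons IHn.
rewrite -[in RHS](odd_double_half m) {2}(divn_eq m./2 (2 ^ n)).
rewrite doubleD addnCA doubleMr -(mul2n (2 ^ n)) -expnS.
rewrite modnMDl [RHS]modn_small // expnS.
by have := @ltn_pmod m./2 (2 ^ n); rewrite expn_gt0 => /(_ isT); lia.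
Qed.

Lemma word_valK n (x : word n) : word_of_nat n (word_val x) = x.
Proof.
elim: n x => [|n IHn] x; first by rewrite tuple0 [RHS]tuple0.
case/tupleP: x => b x; rewrite word_val_cons word_of_nat_cons.
by rewrite oddD odd_double addbF oddb half_bit_double IHn.
Qed.

Lemma word_of_nat_mod n m : word_of_nat n (m %% 2 ^ n) = word_of_nat n m.
Proof. by rewrite -word_of_natK word_valK. Qed.

Lemma word_inc_of_nat n m : word_inc (word_of_nat n m) = word_of_nat n m.+1.
Proof. by rewrite /word_inc word_of_natK modnDml addn1 word_of_nat_mod. Qed.

Lemma word_dec_of_nat n m : word_dec (word_of_nat n m.+1) = word_of_nat n m.
Proof.
rewrite /word_dec word_of_natK modnDml addSnnS -subSn ?expn_gt0 // subn1.
by rewrite modnDr word_of_nat_mod.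
Qed.

Lemma word_val_eq0 n (x : word n) : (word_val x == 0) = (nu x == 0).
Proof.
elim: n x => [|n IHn] x; first by rewrite tuple0 /word_val big_ord0.
case/tupleP: x => b x; rewrite word_val_cons /nu /= !addn_eq0.
by rewrite double_eq0 IHn.
Qed.

Lemma word_map2_cons f n a b (x y : word n) :
  word_map2 f [tuple of a :: x] [tuple of b :: y] =
  [tuple of f a b :: word_map2 f x y].
Proof.
apply: eq_from_tnth => i; rewrite tnth_mktuple.
case: (unliftP ord0 i) => [j|] ->; last by rewrite !tnth0.
by rewrite !tnthS tnth_mktuple.
Qed.

(** Induction from the low end. If the lowest bit is one, the decrement clears only that bit and the
    rest is conjoined with itself; if it is zero, the borrow passes to the higher bits. *)
Lemma nu_and_dec n (x : word n) :
  0 < nu x -> nu (word_and x (word_dec x)) = (nu x).-1.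
Proof.
rewrite lt0n -word_val_eq0 -lt0n => x_gt0.
(* Writing the value as a successor [v.+1] turns the decrement into [word_of_nat n v], which unfolds
   bit by bit. *)
rewrite -{2}(word_valK x) -(prednK x_gt0) word_dec_of_nat.
have: word_val x = (word_val x).-1.+1 by rewrite prednK.
move: (word_val x).-1 => v xv {x_gt0}.
elim: n x v xv => [|n IHn] x v; first by rewrite /word_val big_ord0.
case/tupleP: x => b x; rewrite word_val_cons word_of_nat_cons.
rewrite /word_and word_map2_cons; case: b => xv.
  have ->: v = (word_val x).*2 by lia.
  rewrite odd_double doubleK word_valK.
  suff -> : word_map2 andb x x = x by [].
  by apply: eq_from_tnth => i; rewrite tnth_mktuple andbb.
have xv' : word_val x = v./2.+1 by lia.
by rewrite /nu /= add0n [LHS](IHn _ _ xv').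
Qed.

Lemma nu_not n (x : word n) : nu (word_not x) = n - nu x.
Proof.
rewrite -[X in X - _](size_tuple x) -(count_predC id x) addKn.
by rewrite /nu /word_not -[in RHS](map_tnth_enum x) !count_map.
Qed.

Lemma nu_le n (x : word n) : nu x <= n.
Proof. by rewrite -[X in _ <= X](size_tuple x) count_size. Qed.

Lemma word_orC n (x y : word n) : word_or x y = word_or y x.
Proof. by apply: eq_from_tnth => i; rewrite !tnth_mktuple orbC. Qed.

(** Bit [i] of [a] is clear, so the addition produces no carry. *)
Lemma word_or_pow2 n a i :
  a < 2 ^ i ->
  word_or (word_of_nat n a) (word_of_nat n (2 ^ i)) = word_of_nat n (a + 2 ^ i).
Proof.
move=> lt_a; apply: eq_from_tnth => j; rewrite !tnth_mktuple.
case: (ltngtP j i) => [lt_ji | lt_ij | ->].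
- have dvd_ji : 2 ^ j %| 2 ^ i by rewrite dvdn_exp2l // ltnW.
  rewrite divnDr // oddD -expnB ?(ltnW lt_ji) // oddX subn_eq0 leqNgt lt_ji.
  by rewrite orbF addbF.
- have le_ij : 2 ^ i.+1 <= 2 ^ j by rewrite leq_exp2l.
  by rewrite expnS in le_ij; rewrite !divn_small //; lia.
- by rewrite divnDr // divnn expn_gt0 divn_small.
Qed.

(* The variables: [vx] and [vy] hold what remains of the input and of its
   complement, [vc] counts the bits cleared in each, [vt] is a scratch variable,
   [vp] runs through the powers of two, and [vr] accumulates the word length. *)
Definition vx : var 5 := ord0.
Definition vy : var 5 := @Ordinal 6 1 isT.
Definition vc : var 5 := @Ordinal 6 2 isT.
Definition vt : var 5 := @Ordinal 6 3 isT.
Definition vp : var 5 := @Ordinal 6 4 isT.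
Definition vr : var 5 := @Ordinal 6 5 isT.

(** * The program and its states *)

Definition clear_lowest_one (v : var 5) : prog 5 :=
  Seq (Assign vt (Var v)) (Seq (Dec vt) (And v v vt)).

(* Turns [2 ^ i] into [2 ^ i.+1] as [(2 ^ i || 2 ^ i - 1) + 1]. *)
Definition double_power : prog 5 :=
  Seq (Assign vt (Var vp)) (Seq (Dec vt) (Seq (Or vp vp vt) (Inc vp))).

(** Straight-line code: the digits of [n] are inspected while the program is generated, so no test
    is executed. *)
Fixpoint build_length (n i : nat) : prog 5 :=
  if i is j.+1 then
    Seq (build_length n j)
        (Seq (if odd (n %/ 2 ^ j) then Or vr vr vp else Skip) double_power)
  else Inc vp.

Definition subtract_count : prog 5 :=
  While (Test Ne vc Zero) (Seq (Dec vc) (Dec vr)).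

(** [vx] is cleared at the end so that the enclosing loop stops. *)
Definition complement_count (n : nat) : prog 5 :=
  Seq (build_length n (trunc_log 2 n).+1)
      (Seq subtract_count (Seq (Assign vc (Var vr)) (Assign vx Zero))).

Definition count_loop (n : nat) : prog 5 :=
  While (Test Ne vx Zero)
    (If (Test Eq vy Zero) (complement_count n)
        (Seq (clear_lowest_one vx) (Seq (clear_lowest_one vy) (Inc vc)))).

Definition count_ones (n : nat) : prog 5 := Seq (Not vy vx) (count_loop n).

Definition mk n (x y c t p r : word n) : state n 5 :=
  [ffun v => tnth [tuple x; y; c; t; p; r] v].

Lemma mkE n (x y c t p r : word n) (s := mk x y c t p r) :
  ((s vx = x) * (s vy = y) * (s vc = c) * (s vt = t) * (s vp = p) *
   (s vr = r))%type.
Proof. by rewrite !ffunE. Qed.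

Lemma upd_mk n (x y c t p r w : word n) (s := mk x y c t p r) :
  ((upd s vx w = mk w y c t p r) * (upd s vy w = mk x w c t p r) *
   (upd s vc w = mk x y w t p r) * (upd s vt w = mk x y c w p r) *
   (upd s vp w = mk x y c t w r) * (upd s vr w = mk x y c t p w))%type.
Proof.
by do !split; apply/ffunP => -[[|[|[|[|[|[|//]]]]]] ?]; rewrite !ffunE.
Qed.

Lemma init_mk n (x : word n) (z := word_of_nat n 0) :
  init 5 x = mk x z z z z z.
Proof. by apply/ffunP => -[[|[|[|[|[|[|//]]]]]] ?]; rewrite !ffunE. Qed.

(** Lets the constructors infer the final state and the cost, which are then compared with the
    expected ones. *)
Lemma exec_cast n k (p : prog k) (s s1 s2 : state n k) t1 t2 :
  exec p s t1 s1 -> s1 = s2 -> t1 = t2 -> exec p s t2 s2.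
Proof. by move=> ? <- <-. Qed.

Lemma eval_ne0 n (s : state n 5) v :
  eval_test s (Test Ne v Zero) = (nu (s v) != 0).
Proof. by rewrite /= word_of_natK mod0n word_val_eq0. Qed.

Lemma eval_eq0 n (s : state n 5) v :
  eval_test s (Test Eq v Zero) = (nu (s v) == 0).
Proof. by rewrite /= word_of_natK mod0n word_val_eq0. Qed.

(** * Effect and cost of each block *)

Lemma exec_clear_x n (x y c t p r : word n) :
  exec (clear_lowest_one vx) (mk x y c t p r) 3
    (mk (word_and x (word_dec x)) y c (word_dec x) p r).
Proof.
apply: exec_cast; first by do !econstructor.
  by rewrite /= !(upd_mk, mkE).
by [].
Qed.

Lemma exec_clear_y n (x y c t p r : word n) :
  exec (clear_lowest_one vy) (mk x y c t p r) 3
    (mk x (word_and y (word_dec y)) c (word_dec y) p r).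
Proof.
apply: exec_cast; first by do !econstructor.
  by rewrite /= !(upd_mk, mkE).
by [].
Qed.

Lemma exec_double_power n (x y c t r : word n) i :
  exec double_power (mk x y c t (word_of_nat n (2 ^ i)) r) 4
    (mk x y c (word_of_nat n (2 ^ i).-1) (word_of_nat n (2 ^ i.+1)) r).
Proof.
have pow_gt0 : 0 < 2 ^ i by rewrite expn_gt0.
have decE : word_dec (word_of_nat n (2 ^ i)) = word_of_nat n (2 ^ i).-1.
  by rewrite -{1}(prednK pow_gt0) word_dec_of_nat.
apply: exec_cast; first by do !econstructor.
  rewrite /= !(upd_mk, mkE) decE word_orC word_or_pow2 ?ltn_predL //.
  by rewrite word_inc_of_nat -addSn prednK // addnn -mul2n -expnS.
by [].
Qed.

Lemma exec_build_length n (x y c t : word n) i :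
  exists T t', exec (build_length n i)
      (mk x y c t (word_of_nat n 0) (word_of_nat n 0)) T
      (mk x y c t' (word_of_nat n (2 ^ i)) (word_of_nat n (n %% 2 ^ i))) /\
    T <= 5 * i + 1.
Proof.
elim: i => [|i [T [t' [exec_i leT]]]].
  exists 1, t; split=> //; apply: exec_cast; first by econstructor.
    by rewrite /= !(upd_mk, mkE) word_inc_of_nat modn1.
  by [].
have nmod : n %% 2 ^ i.+1 = n %% 2 ^ i + odd (n %/ 2 ^ i) * 2 ^ i.
  rewrite {1}(divn_eq n (2 ^ i)) -{1}(odd_double_half (n %/ 2 ^ i)).
  rewrite mulnDl -doubleMl doubleMr -(mul2n (2 ^ i)) -expnS -addnA addnCA modnMDl.
  rewrite addnC [LHS]modn_small // expnS.
  have := @ltn_pmod n (2 ^ i); rewrite expn_gt0 => /(_ isT).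
  by case: odd; lia.
rewrite nmod; exists (T + (odd (n %/ 2 ^ i) + 4)).
exists (word_of_nat n (2 ^ i).-1); split; last by case: odd; lia.
apply: ExecSeq exec_i _; apply: ExecSeq (exec_double_power _ _ _ _ _ _).
case: odd; last by rewrite addn0; apply: ExecSkip.
rewrite mul1n -word_or_pow2 ?ltn_pmod ?expn_gt0 //.
apply: exec_cast; first by econstructor.
  by rewrite /= !(upd_mk, mkE).
by [].
Qed.

Lemma word_of_nat_neq0 n m : 0 < m <= n -> nu (word_of_nat n m) != 0.
Proof.
case/andP=> m_gt0 le_mn; rewrite -word_val_eq0 word_of_natK modn_small -?lt0n //.
exact: leq_ltn_trans le_mn (ltn_expl n _).
Qed.

Lemma nu_word_of_nat0 n : nu (word_of_nat n 0) = 0.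
Proof. by apply/eqP; rewrite -word_val_eq0 word_of_natK mod0n. Qed.

Lemma exec_subtract_count n (x y t p : word n) c r :
  c <= r <= n ->
  exec subtract_count (mk x y (word_of_nat n c) t p (word_of_nat n r))
    (3 * c + 1) (mk x y (word_of_nat n 0) t p (word_of_nat n (r - c))).
Proof.
elim: c r => [|c IHc] [|r] // /andP[le_cr le_rn].
- by apply: ExecWhileFalse; rewrite eval_ne0 mkE nu_word_of_nat0.
- by apply: ExecWhileFalse; rewrite eval_ne0 mkE nu_word_of_nat0.
apply: exec_cast.
- apply: ExecWhileTrue.
  + by rewrite eval_ne0 mkE word_of_nat_neq0 //=; lia.
  + by do !econstructor.
  + rewrite !(upd_mk, mkE) !word_dec_of_nat; apply: IHc; lia.
- by [].
- lia.
Qed.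

Lemma exec_complement_count n (x y t : word n) c (z := word_of_nat n 0) :
  0 < n -> c <= n ->
  exists T s, [/\ exec (complement_count n) (mk x y (word_of_nat n c) t z z) T s,
    s vx = z, s vc = word_of_nat n (n - c)
    & T <= 3 * c + 5 * trunc_log 2 n + 9].
Proof.
move=> n_gt0 le_cn.
have [T [t' []]] :=
  exec_build_length x y (word_of_nat n c) t (trunc_log 2 n).+1.
(* [n] lies below two to the power [(trunc_log 2 n).+1], so all its digits have been assembled. *)
rewrite modn_small ?trunc_log_ltn // => exec_build leT.
do 2!eexists; split.
- apply: ExecSeq exec_build _.
  apply: ExecSeq (exec_subtract_count _ _ _ _ _) _; first by rewrite le_cn leqnn.
  by do !econstructor.
- by rewrite /= !(upd_mk, mkE).
- by rewrite /= !(upd_mk, mkE).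
- by lia.
Qed.

(** A round costs 9: two tests, two clearings of 3 and one increment. If [y] vanishes first, the
    final count is [c + nu y], and subtracting it costs 3 per unit, whence 12 per one of [y]. The
    invariant then makes [n] minus that count equal to [c + nu x]. *)
Lemma exec_count_loop n (x y t : word n) c (z := word_of_nat n 0) :
  0 < n -> nu x + nu y + c.*2 = n ->
  exists T s, [/\ exec (count_loop n) (mk x y (word_of_nat n c) t z z) T s,
    s vc = word_of_nat n (c + nu x)
    & T <= if nu x <= nu y then 9 * nu x + 1
           else 12 * nu y + 3 * c + 5 * trunc_log 2 n + 12].
Proof.
move=> n_gt0; move: {-1}(nu x) (erefl (nu x)) => a.
elim: a x y c t => [|a IHa] x y c t nux sum_n.
  exists 1, (mk x y (word_of_nat n c) t z z); split; last by [].
    by apply: ExecWhileFalse; rewrite eval_ne0 mkE nux.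
  by rewrite mkE addn0.
have x_neq0 : eval_test (mk x y (word_of_nat n c) t z z) (Test Ne vx Zero).
  by rewrite eval_ne0 mkE nux.
have [nuy | nuy_gt0] := posnP (nu y).
  have [|T [s [exec_s s_x s_c leT]]] := @exec_complement_count n x y t c n_gt0.
    by lia.
  exists (T.+1 + 1).+1, s; split.
  - apply: ExecWhileTrue x_neq0 _ _.
      by apply: ExecIfTrue exec_s; rewrite eval_eq0 mkE nuy.
    by apply: ExecWhileFalse; rewrite eval_ne0 s_x nu_word_of_nat0.
  - by rewrite s_c; congr word_of_nat; lia.
  - by rewrite nuy /=; lia.
have nux' : nu (word_and x (word_dec x)) = a by rewrite nu_and_dec nux.
have nuy' := nu_and_dec nuy_gt0.
have [|T [s [exec_s s_c leT]]] :=
  IHa _ (word_and y (word_dec y)) c.+1 (word_dec y) nux'.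
  by rewrite nuy' doubleS; lia.
exists (7.+1 + T).+1, s; split.
- apply: ExecWhileTrue x_neq0 _ exec_s.
  apply: ExecIfFalse; first by rewrite eval_eq0 mkE -lt0n.
  apply: exec_cast.
  + apply: ExecSeq (exec_clear_x _ _ _ _ _ _) _.
    apply: ExecSeq (exec_clear_y _ _ _ _ _ _) _.
    exact: ExecInc.
  + by rewrite upd_mk mkE word_inc_of_nat.
  + by [].
- by rewrite s_c addSnnS.
- by move: leT; rewrite nuy'; do 2!case: ifP; lia.
Qed.

(* The program may depend on the word length n (n is not an input and the only
   constant is zero, so n has to be assembled by the program, whence log n);
   the number k.+1 of variables, the output variable and c do not.  The bound is clamped below by 1 because it
   vanishes at x = 0, where a correct program still takes a step. *)
Theorem theorem2 :
  exists (k : nat) (P : nat -> prog k) (out : var k) (c : nat),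
  forall (n : nat), 0 < n -> forall x : word n,
  exists (t : nat) (s : state n k),
    [/\ exec (P n) (init k x) t s,
        word_val (s out) = nu x
      & t <= c * maxn 1 (minn (nu x) (n - nu x + trunc_log 2 n))].
Proof.
(* 30 is generous: the two cases need at most 11 and 25. *)
exists 5, count_ones, vc, 30 => n n_gt0 x.
have le_nu := nu_le x.
have [|T [s [exec_s s_c leT]]] :=
  @exec_count_loop n x (word_not x) (word_of_nat n 0) 0 n_gt0.
  by rewrite nu_not; lia.
exists (1 + T), s; split.
- apply: ExecSeq exec_s; apply: exec_cast; first by econstructor.
    by rewrite init_mk upd_mk mkE.
  by [].
- rewrite s_c word_of_natK modn_small //.
  exact: leq_ltn_trans le_nu (ltn_expl n _).
- move: leT; rewrite nu_not; case: ifP => [|/negbT]; first lia.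
  rewrite -ltnNge => lt_nu leT.
  (* Needed when the minimum is [nu x]: the logarithmic cost is absorbed because [2 ^ trunc_log 2 n
     <= n < 2 * nu x <= 2 ^ nu x]. *)
  have lt_log : trunc_log 2 n < nu x.
    rewrite -(ltn_exp2l _ _ (ltnSn 1)).
    apply: leq_ltn_trans (trunc_logP (ltnSn 1) n_gt0) _.
    case: (nu x) lt_nu => [|m] //; rewrite expnS.
    have := ltn_expl m (ltnSn 1); lia.
  lia.
Qed.
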